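(* For any natural number $N$ and any positive integer $n$, \begin{equation*} \mathrm{spt}(n, N) = \frac{1}{2}\left(M_{2,N}(n)- N_{2,N}(n)\right), \end{equation*} equivalently, \begin{equation*} \mathrm{spt}(n, N) = \sum_{j=0}^{n-1}p(j, N)\sigma(n-j, N)-\frac{1}{2}N_{2,N}(n),\qquad \sigma(k, N)=\sum_{d\mid k,\ d\geq k/N}d. \end{equation*}
   Context: For a partition $\pi$: $|\pi|$ is its sum, $l(\pi)$ its largest part, $\#(\pi)$ its number of parts, $\mathrm{rank}(\pi)=l(\pi)-\#(\pi)$. $p(n,N)$ is the number of partitions of $n$ with largest part $\leq N$ ($p(0,N)=1$). $\mathrm{spt}(n,N)$ is the total number of occurrences of the smallest part, summed over all partitions of $n$ with largest part $\leq N$. Finite rank counts: for $1\leq j\leq N$, consider pairs $(\pi_1,\pi_2)$ with $\pi_1$ a partition into distinct parts, empty or with all parts in $[N-j+1,N]$, and $\pi_2$ a partition with Durfee square of size $j$; weight $(-1)^{\#(\pi_1)}$, size $|\pi_1|+|\pi_2|$, rank $\mathrm{rank}(\pi_2)$. $N_{S_1}(m,n)$ is the sum over $j=1,\dots,N$ of the weighted count of such pairs of size $n$ and rank $m$. Finite crank counts: $M_{S_2}(m,n)$ is the sum of $(-1)^{\#(\pi_1)}$ over triples $(\pi_1,\pi_2,\pi_3)$ with $\pi_1$ into distinct parts, $\pi_2,\pi_3$ arbitrary partitions, all largest parts $\leq N$, $|\pi_1|+|\pi_2|+|\pi_3|=n$ and $\#(\pi_2)-\#(\pi_3)=m$. Moments: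 $N_{k,N}(n)=\sum_{m\in\mathbb{Z}} m^kN_{S_1}(m,n)$ and $M_{k,N}(n)=\sum_{m\in\mathbb{Z}}m^kM_{S_2}(m,n)$. *)

(* Defs.v *)
From mathcomp Require Import all_boot all_order all_algebra finmap.
From mathcomp Require Import mathcomp_extra boolp classical_sets functions.
From mathcomp Require Import cardinality fsbigop.
Set Implicit Arguments.
Unset Strict Implicit.
Unset Printing Implicit Defensive.
Import Order.TTheory GRing.Theory Num.Theory.
Local Open Scope classical_set_scope.
Local Open Scope ring_scope.

(* A partition is the weakly decreasing list of its positive parts.  Its sum  *)
(* is [sumn pi] and its number of parts is [size pi].                         *)
Definition is_partition (pi : seq nat) : bool :=
  sorted geq pi && (0%N \notin pi).

Definition largest (pi : seq nat) : nat := head 0%N pi.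

Definition smallest (pi : seq nat) : nat := last 0%N pi.

Definition rank (pi : seq nat) : int := (largest pi)%:Z - (size pi)%:Z.

(* The largest j such that at least j parts are >= j. *)
Definition durfee (pi : seq nat) : nat :=
  (\max_(j < (size pi).+1 | j <= count (fun a => j <= a) pi) j)%N.

Definition partitions_le (n N : nat) : set (seq nat) :=
  [set pi | [&& is_partition pi, sumn pi == n & (largest pi <= N)%N]].

Definition num_part (n N : nat) : nat := #|` fset_set (partitions_le n N)|.

Definition spt (n N : nat) : nat :=
  \sum_(pi \in partitions_le n N) count_mem (smallest pi) pi.

Definition S1 (N j : nat) (m : int) (n : nat) : set (seq nat * seq nat) :=
  [set x | [/\ is_partition x.1, uniq x.1 & all (fun a => N - j < a <= N)%N x.1]
        /\ [/\ is_partition x.2, durfee x.2 = j,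
               (sumn x.1 + sumn x.2)%N = n & rank x.2 = m]].

Definition N_S1 (N : nat) (m : int) (n : nat) : int :=
  \sum_(1 <= j < N.+1) \sum_(x \in S1 N j m n) (-1 : int) ^+ size x.1.

Definition S2 (N : nat) (m : int) (n : nat) : set (seq nat * seq nat * seq nat) :=
  [set x | let: (pi1, pi2, pi3) := x in
    [/\ is_partition pi1, uniq pi1, is_partition pi2 & is_partition pi3] /\
    [/\ (largest pi1 <= N)%N, (largest pi2 <= N)%N & (largest pi3 <= N)%N] /\
    (sumn pi1 + sumn pi2 + sumn pi3)%N = n /\
    (size pi2)%:Z - (size pi3)%:Z = m].

Definition M_S2 (N : nat) (m : int) (n : nat) : int :=
  \sum_(x \in S2 N m n) (-1 : int) ^+ size x.1.1.

Definition rank_moment (k N n : nat) : int :=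
  \sum_(m \in [set: int]) m ^+ k * N_S1 N m n.

Definition crank_moment (k N n : nat) : int :=
  \sum_(m \in [set: int]) m ^+ k * M_S2 N m n.

(* The condition d >= k / N is cleared of its denominator. *)
Definition sigma (k N : nat) : nat :=
  (\sum_(d <- divisors k | k <= d * N) d)%N.

(* The set-indexed sums and the cardinal above take the value 0 when the      *)
(* index set (or the support) is infinite; the following facts show that this *)
(* never happens.                                                             *)

Lemma partition_bounds (pi : seq nat) : is_partition pi ->
  (size pi <= sumn pi)%N /\ all (fun a => a <= sumn pi)%N pi.
Proof.
case/andP=> _; elim: pi => //= a s IH; rewrite inE negb_or => /andP[a0 /IH[h1 h2]].
rewrite leq_addr; split; first by rewrite -add1n leq_add // lt0n eq_sym.
by apply: sub_all h2 => b /leq_trans; apply; rewrite leq_addl.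
Qed.

Lemma finite_partitions_sumn_le (n : nat) :
  finite_set [set pi | is_partition pi && (sumn pi <= n)%N].
Proof.
pose f (t : {k : 'I_n.+1 & (val k).-tuple 'I_n.+1}) : seq nat :=
  [seq val i | i <- tagged t].
apply: (@sub_finite_set _ _ (f @` setT)); last exact/finite_image/finite_finset.
move=> pi /= /andP[/partition_bounds[hs ha] hn].
have hk : (size pi < n.+1)%N by rewrite ltnS (leq_trans hs).
have ht : size [seq inord a : 'I_n.+1 | a <- pi] == val (Ordinal hk).
  by rewrite size_map.
exists (Tagged (fun k : 'I_n.+1 => (val k).-tuple 'I_n.+1) (Tuple ht)) => //.
rewrite /f /= -map_comp -[RHS]map_id; apply/eq_in_map => a /(allP ha) h /=.
by rewrite inordK // ltnS (leq_trans h).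
Qed.

Lemma finite_partitions_le (n N : nat) : finite_set (partitions_le n N).
Proof.
apply: sub_finite_set (finite_partitions_sumn_le n) => pi /= /and3P[-> /eqP -> _].
by rewrite leqnn.
Qed.

Lemma finite_S1_all (N j n : nat) : finite_set (\bigcup_m S1 N j m n).
Proof.
have h := finite_partitions_sumn_le n.
apply: sub_finite_set (finite_setX h h) => -[a b] [m _] /=.
by case=> -[/= -> _ _] [-> _ <- _]; rewrite leq_addr leq_addl.
Qed.

Lemma finite_S1 (N j : nat) (m : int) (n : nat) : finite_set (S1 N j m n).
Proof. by apply: sub_finite_set (finite_S1_all N j n) => x hx; exists m. Qed.

Lemma finite_S2_all (N n : nat) : finite_set (\bigcup_m S2 N m n).
Proof.
have h := finite_partitions_sumn_le n.
apply: sub_finite_set (finite_setX (finite_setX h h) h) => -[[a b] c] [m _] /=.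
case=> -[-> _ -> ->] [_ [<- _]] /=; split; last exact: leq_addl.
by rewrite -addnA leq_addr addnCA leq_addr.
Qed.

Lemma finite_S2 (N : nat) (m : int) (n : nat) : finite_set (S2 N m n).
Proof. by apply: sub_finite_set (finite_S2_all N n) => x hx; exists m. Qed.

Lemma finite_supp_N_S1 (N n : nat) : finite_set [set m | N_S1 N m n != 0].
Proof.
apply: (@sub_finite_set _ _ (\bigcup_(j in `I_N.+1)
    (fun x => rank x.2) @` (\bigcup_m S1 N j m n))); last first.
  apply: bigcup_finite => [|j _]; first exact: finite_II.
  exact/finite_image/finite_S1_all.
move=> m /= hm; apply: contrapT => hn; case/negP: hm; apply/eqP.
rewrite /N_S1 big_nat; apply: big1 => j /andP[_ jN]; apply: fsbig1 => x hx.
case: hn; exists j => //; exists x; first by exists m.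
by case: hx => _ [].
Qed.

Lemma finite_supp_M_S2 (N n : nat) : finite_set [set m | M_S2 N m n != 0].
Proof.
apply: (@sub_finite_set _ _
    ((fun x => (size x.1.2)%:Z - (size x.2)%:Z) @` (\bigcup_m S2 N m n))); last first.
  exact/finite_image/finite_S2_all.
move=> m /= hm; apply: contrapT => hn; case/negP: hm; apply/eqP.
apply: fsbig1 => x hx; case: hn; exists x; first by exists m.
by case: x hx => [[a b] c] [_ [_ []]].
Qed.

(* Main.v *)
From HB Require Import structures.
From mathcomp Require Import all_boot all_order all_algebra.
From mathcomp Require Import boolp classical_sets functions cardinality.
From mathcomp Require Import fsbigop zify ring.
Require Import Defs.
Set Implicit Arguments.
Unset Strict Implicit.
Unset Printing Implicit Defensive.
Import GRing.Theory.
Local Open Scope classical_set_scope.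
Local Open Scope ring_scope.

(** Write (q)_n = (1-q)...(1-q^n), A_i = q^i/(1-q^i)^2 and H_n = A_1+...+A_n.
    A partition into parts at most n is a family of independent multiplicities,
    so formally its number of parts is a sum of independent geometric variables,
    and A_i is the variance of the i-th one.  The crank is the difference of two
    independent copies of this statistic, with n = N; splitting a partition
    along its Durfee square of side j, so is the rank, with n = j.  They have
    mean 0 and variance 2 H_N, respectively 2 H_j, whence
      1/2 sum_n M_{2,N}(n) q^n = H_N / (q)_N,
      1/2 sum_n N_{2,N}(n) q^n = sum_(1<=j<=N) c(N,j) H_j / (q)_N
    with c(N,j) = q^(j^2) (q)_N^2 / ((q)_(N-j) (q)_j^2), while adding copies of
    the part N to partitions with smaller parts gives
      sum_n spt(n,N) q^n = sum_(1<=i<=N) A_i (q)_i / (q)_N.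
    The weights c(N,j) add up to 1 over 0 <= j <= N, obey a Pascal rule, and
    satisfy q^(N+j-1) c(N-1,j-1) A_j = A_N c(N,j).  Hence the sum of the
    c(N,j) H_j grows by A_N (1 - (q)_N) from N-1 to N, and is equal to
    sum_(i<=N) A_i (1 - (q)_i). *)

(** * Durfee weights *)

Section DurfeeWeights.
Variables (R : comUnitRingType) (q : R).
Hypothesis unit_1subX : forall n, 1 - q ^+ n.+1 \is a GRing.unit.

Definition qpoch n : R := \prod_(1 <= i < n.+1) (1 - q ^+ i).

Definition lambert i : R := q ^+ i / (1 - q ^+ i) ^+ 2.

Definition lambert_sum n : R := \sum_(1 <= i < n.+1) lambert i.

Definition durfee_weight n j : R :=
  if (j <= n)%N then q ^+ (j ^ 2) * qpoch n ^+ 2 / qpoch (n - j) / qpoch j ^+ 2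
  else 0.

Lemma qpoch0 : qpoch 0 = 1.
Proof. by rewrite /qpoch big_nil. Qed.

Lemma qpochS n : qpoch n.+1 = qpoch n * (1 - q ^+ n.+1).
Proof. by rewrite /qpoch big_nat_recr. Qed.

Lemma lambert_sum0 : lambert_sum 0 = 0.
Proof. by rewrite /lambert_sum big_nil. Qed.

Lemma lambert_sumS n : lambert_sum n.+1 = lambert_sum n + lambert n.+1.
Proof. by rewrite /lambert_sum big_nat_recr. Qed.

Lemma qpoch_unit n : qpoch n \is a GRing.unit.
Proof.
elim: n => [|n IH]; first by rewrite qpoch0 unitr1.
by rewrite qpochS unitrM IH unit_1subX.
Qed.

Lemma qpochVS n : (qpoch n.+1)^-1 = (1 - q ^+ n.+1)^-1 / qpoch n.
Proof. by rewrite qpochS invrM ?qpoch_unit ?unit_1subX. Qed.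

Lemma qpochVK n : (qpoch n)^-1 = (1 - q ^+ n.+1) / qpoch n.+1.
Proof. by rewrite qpochVS mulrA divrr // mul1r. Qed.

Lemma durfee_weight_gt n j : (n < j)%N -> durfee_weight n j = 0.
Proof. by rewrite /durfee_weight ltnNge => /negbTE ->. Qed.

Lemma durfee_weight0 n : durfee_weight n 0 = qpoch n.
Proof.
rewrite /durfee_weight subn0 qpoch0 expr0 mul1r expr1n divr1 expr2.
by rewrite mulrK ?qpoch_unit.
Qed.

(* The analogue of [j C(n, j) = n C(n - 1, j - 1)]. *)
Lemma durfee_weight_absorb n j :
  (1 - q ^+ j.+1) ^+ 2 * durfee_weight n.+1 j.+1 =
  (1 - q ^+ n.+1) ^+ 2 * q ^+ (j + j.+1) * durfee_weight n j.
Proof.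
rewrite /durfee_weight ltnS subSS; case: leqP => _; last by rewrite !mulr0.
rewrite qpochS -!exprVn [(qpoch j)^-1]qpochVK.
by rewrite (_ : j.+1 ^ 2 = j ^ 2 + (j + j.+1))%N ?exprD -?mulnn; [ring | lia].
Qed.

(* The analogue of Pascal's rule. *)
Lemma durfee_weightS n j :
  durfee_weight n.+1 j.+1 =
  (1 - q ^+ (n + j).+2) * durfee_weight n j.+1
  + q ^+ (n + j).+1 * durfee_weight n j.
Proof.
have sqrS i : (i.+1 ^ 2 = i ^ 2 + (i + i.+1))%N by rewrite -!mulnn; lia.
have [ltnj|] := ltnP n j.
  by rewrite !durfee_weight_gt ?mulr0 ?addr0 //; lia.
rewrite leq_eqVlt => /predU1P[->|ltjn].
  rewrite (durfee_weight_gt (ltnSn n)) mulr0 add0r /durfee_weight !leqnn !subnn.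
  rewrite -!exprVn [(qpoch n)^-1]qpochVK qpochS sqrS addnS exprD qpoch0.
  by ring.
rewrite /durfee_weight ltnS ltjn (ltnW ltjn) subSS.
have [d nE] : exists d, n = (d + j.+1)%N by exists (n - j.+1)%N; rewrite subnK.
have [-> ->] : (n - j.+1 = d)%N /\ (n - j = d.+1)%N by lia.
rewrite -!exprVn [(qpoch d)^-1]qpochVK [(qpoch j)^-1]qpochVK qpochS sqrS nE.
rewrite (_ : (d + j.+1).+1 = d.+1 + j.+1)%N; last lia.
rewrite (_ : (d + j.+1 + j).+2 = d.+1 + (j.+1 + j.+1))%N; last lia.
rewrite (_ : (d + j.+1 + j).+1 = d + (j.+1 + j.+1))%N; last lia.
by rewrite !exprD !exprS; ring.
Qed.

Lemma durfee_weight0S n :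
  durfee_weight n.+1 0 = (1 - q ^+ n.+1) * durfee_weight n 0.
Proof. by rewrite !durfee_weight0 qpochS mulrC. Qed.

Lemma sum_durfee_weightS n (h : nat -> R) :
  \sum_(0 <= j < n.+2) durfee_weight n.+1 j * h j =
  \sum_(0 <= j < n.+1) durfee_weight n j * h j
  + \sum_(0 <= j < n.+1) q ^+ (n + j).+1 * durfee_weight n j * (h j.+1 - h j).
Proof.
rewrite big_nat_recl // durfee_weight0S.
under eq_bigr do rewrite durfee_weightS mulrDl.
rewrite big_split addrA /=.
have -> : (1 - q ^+ n.+1) * durfee_weight n 0 * h 0
    + \sum_(0 <= j < n.+1)
        (1 - q ^+ (n + j).+2) * durfee_weight n j.+1 * h j.+1 =
    \sum_(0 <= j < n.+1) (1 - q ^+ (n + j).+1) * durfee_weight n j * h j.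
  rewrite big_nat_recr //= (durfee_weight_gt (ltnSn n)) mulr0 mul0r addr0.
  rewrite [RHS]big_nat_recl // addn0; congr (_ + _).
  by under eq_bigr do rewrite -addnS.
by rewrite -!big_split /=; apply: eq_bigr => j _; ring.
Qed.

Lemma sum_durfee_weight n : \sum_(0 <= j < n.+1) durfee_weight n j = 1.
Proof.
elim: n => [|n IH]; first by rewrite big_nat1 durfee_weight0 qpoch0.
have := sum_durfee_weightS n (fun=> 1).
under eq_bigr do rewrite mulr1; under [in RHS]eq_bigr do rewrite mulr1.
by rewrite IH [X in _ + X]big1 ?addr0 // => j _; rewrite subrr mulr0.
Qed.

Lemma lambert_durfee_weight n j :
  q ^+ (n + j).+1 * durfee_weight n j * lambert j.+1 =
  lambert n.+1 * durfee_weight n.+1 j.+1.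
Proof.
have unit_sqr i : (1 - q ^+ i.+1) ^+ 2 \is a GRing.unit.
  by rewrite unitrX ?unit_1subX.
apply: (mulrI (unit_sqr j)); apply: (mulrI (unit_sqr n)).
have lambertK i : (1 - q ^+ i.+1) ^+ 2 * lambert i.+1 = q ^+ i.+1.
  by rewrite mulrC divrK.
transitivity ((1 - q ^+ n.+1) ^+ 2 * q ^+ (n + j).+1 * durfee_weight n j
    * ((1 - q ^+ j.+1) ^+ 2 * lambert j.+1)); first by ring.
transitivity (((1 - q ^+ n.+1) ^+ 2 * lambert n.+1)
    * ((1 - q ^+ j.+1) ^+ 2 * durfee_weight n.+1 j.+1)); last by ring.
by rewrite !lambertK durfee_weight_absorb -addSn !exprD; ring.
Qed.

Lemma sum_durfee_weight_lambert n :
  \sum_(1 <= j < n.+1) durfee_weight n j * lambert_sum j =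
  \sum_(1 <= i < n.+1) lambert i * (1 - qpoch i).
Proof.
transitivity (\sum_(0 <= j < n.+1) durfee_weight n j * lambert_sum j).
  by rewrite [RHS]big_ltn // lambert_sum0 mulr0 add0r.
elim: n => [|n IH]; first by rewrite big_nat1 lambert_sum0 mulr0 big_nil.
rewrite sum_durfee_weightS IH [RHS]big_nat_recr //=; congr (_ + _).
under eq_bigr do
  rewrite lambert_sumS addrAC subrr add0r lambert_durfee_weight.
rewrite -mulr_sumr -(sum_durfee_weight n.+1) [in RHS]big_nat_recl //.
by rewrite durfee_weight0 addrAC subrr add0r.
Qed.

Theorem sum_lambert_qpoch n :
  \sum_(1 <= i < n.+1) lambert i * qpoch i =
  lambert_sum n - \sum_(1 <= j < n.+1) durfee_weight n j * lambert_sum j.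
Proof.
rewrite sum_durfee_weight_lambert -sumrB.
by apply: eq_bigr => i _; rewrite mulrBr mulr1 subKr.
Qed.

End DurfeeWeights.

(** * Formal power series *)

Definition fps (R : Type) : Type := nat -> R.

HB.instance Definition _ (R : zmodType) :=
  GRing.Zmodule.copy (fps R) (nat -> R).

Section FormalPowerSeriesRing.
Variable R : comNzRingType.
Implicit Types f g h : fps R.

Definition fps_trunc k f : {poly R} := \poly_(i < k) f i.

Definition fps_one : fps R := fun n => (n == 0%N)%:R.

Definition fps_mul f g : fps R := fun n => \sum_(i < n.+1) f i * g (n - i)%N.

Lemma coef_fps_trunc k f n : (n < k)%N -> (fps_trunc k f)`_n = f n.
Proof. by move=> nk; rewrite coef_poly nk. Qed.

Lemma coef_fps_truncM k f g n : (n < k)%N ->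
  (fps_trunc k f * fps_trunc k g)`_n = fps_mul f g n.
Proof.
move=> nk; rewrite coefM; apply: eq_bigr => i _.
by rewrite !coef_fps_trunc //; have := ltn_ord i; lia.
Qed.

Lemma fps_mulC : commutative fps_mul.
Proof.
by move=> f g; apply/funext => n; rewrite -!(@coef_fps_truncM n.+1) // mulrC.
Qed.

Lemma fps_mulA : associative fps_mul.
Proof.
move=> f g h; apply/funext => n.
transitivity ((fps_trunc n.+1 f * (fps_trunc n.+1 g * fps_trunc n.+1 h))`_n).
  rewrite coefM; apply: eq_bigr => i _.
  by rewrite coef_fps_trunc // coef_fps_truncM // ltnS leq_subr.
rewrite mulrA coefM; apply: eq_bigr => i _.
by rewrite coef_fps_truncM // coef_fps_trunc // ltnS leq_subr.
Qed.

Lemma fps_mul1 : left_id fps_one fps_mul.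
Proof.
move=> f; apply/funext => n.
rewrite /fps_mul big_ord_recl mul1r subn0 big1 ?addr0 // => i _.
by rewrite /fps_one mul0r.
Qed.

Lemma fps_mulDl : left_distributive fps_mul +%R.
Proof.
move=> f g h; apply/funext => n; rewrite /fps_mul -[RHS]big_split /=.
by apply: eq_bigr => i _; rewrite -mulrDl.
Qed.

Lemma fps_one_neq0 : fps_one != 0.
Proof. by apply/eqP => /(congr1 (@^~ 0%N)) /eqP; rewrite oner_eq0. Qed.

HB.instance Definition _ := GRing.Zmodule_isComNzRing.Build (fps R)
  fps_mulA fps_mulC fps_mul1 fps_mulDl fps_one_neq0.

Lemma coef_fpsD f g n : (f + g) n = f n + g n.
Proof. by []. Qed.

Lemma coef_fpsN f n : (- f) n = - f n.
Proof. by []. Qed.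

Lemma coef_fps1 n : (1 : fps R) n = (n == 0%N)%:R.
Proof. by []. Qed.

Lemma coef_fpsM f g n : (f * g) n = \sum_(i < n.+1) f i * g (n - i)%N.
Proof. by []. Qed.

Lemma coef_fpsMn f k n : (f *+ k) n = f n *+ k.
Proof. by elim: k => // k IH; rewrite !mulrS coef_fpsD IH. Qed.

Lemma coef_fps_sum I (r : seq I) (P : pred I) (F : I -> fps R) n :
  (\sum_(i <- r | P i) F i) n = \sum_(i <- r | P i) F i n.
Proof. exact: (big_morph (fun f : fps R => f n)). Qed.

Lemma coef0_fpsM f g : (f * g) 0%N = f 0%N * g 0%N.
Proof. by rewrite coef_fpsM big_ord1. Qed.

Definition fpsX : fps R := fun n => (n == 1%N)%:R.

Lemma coef_fpsXM f n : (fpsX * f) n = if n is m.+1 then f m else 0.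
Proof.
rewrite coef_fpsM /fpsX; case: n => [|n]; first by rewrite big_ord1 mul0r.
rewrite 2!big_ord_recl mul0r add0r mul1r big1 => [|i _]; last by rewrite mul0r.
by rewrite addr0 subn1.
Qed.

Lemma coef_fpsXnM f d n :
  (fpsX ^+ d * f) n = if (d <= n)%N then f (n - d)%N else 0.
Proof.
elim: d n => [|d IH] n; first by rewrite mul1r subn0.
by rewrite exprS -mulrA coef_fpsXM; case: n => // n; rewrite IH.
Qed.

Lemma coef_fpsXn d n : (fpsX ^+ d) n = (n == d)%:R.
Proof.
rewrite -[fpsX ^+ d]mulr1 coef_fpsXnM coef_fps1 subn_eq0 eqn_leq andbC.
by case: leqP.
Qed.

Definition fpsC (c : R) : fps R := fun n => if n is 0%N then c else 0.

Lemma coef_fpsCM c f n : (fpsC c * f) n = c * f n.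
Proof.
rewrite coef_fpsM big_ord_recl subn0 big1 ?addr0 // => i _.
by rewrite mul0r.
Qed.

Lemma fpsC0 : fpsC 0 = 0.
Proof. by apply/funext => -[]. Qed.

Lemma fpsC1 : fpsC 1 = 1.
Proof. by apply/funext => -[]. Qed.

Lemma coef_fpsX_small f k n : f 0%N = 0 -> (n < k)%N -> (f ^+ k) n = 0.
Proof.
move=> f0; elim: k n => // k IH n nk.
rewrite exprS coef_fpsM big_ord_recl f0 mul0r add0r big1 // => i _.
by rewrite IH ?mulr0 // lift0; have := ltn_ord i; lia.
Qed.

Definition fps_geom f : fps R := fun n => (\sum_(k < n.+1) f ^+ k) n.

Lemma coef_fps_geom f m n : f 0%N = 0 -> (n <= m)%N ->
  fps_geom f n = (\sum_(k < m.+1) f ^+ k) n.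
Proof.
move=> f0 nm; rewrite /fps_geom !coef_fps_sum.
rewrite (big_ord_widen m.+1 (fun k => (f ^+ k) n)) //.
rewrite big_mkcond; apply: eq_bigr => k _; case: ltnP => // nk.
by rewrite coef_fpsX_small.
Qed.

Lemma fps_geomP f : f 0%N = 0 -> (1 - f) * fps_geom f = 1.
Proof.
move=> f0; apply/funext => n.
transitivity (((1 - f) * \sum_(k < n.+1) f ^+ k) n).
  by apply: eq_bigr => i _; rewrite (coef_fps_geom f0 (leq_subr i n)).
rewrite -opprB mulNr -subrX1 opprB coef_fpsD coef_fpsN.
by rewrite coef_fpsX_small ?subr0.
Qed.

End FormalPowerSeriesRing.

Arguments fpsX {R}.

Section FormalPowerSeriesUnits.
Variable R : comUnitRingType.
Implicit Types f g : fps R.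

Definition fps_unit : {pred fps R} := fun f => f 0%N \is a GRing.unit.

Definition fps_inv f : fps R :=
  if f 0%N \is a GRing.unit
  then fpsC (f 0%N)^-1 * fps_geom (1 - fpsC (f 0%N)^-1 * f) else f.

Lemma fps_mulVf : {in fps_unit, left_inverse 1 fps_inv *%R}.
Proof.
move=> f uf; rewrite /fps_inv ifT // mulrAC -[X in X * _](subKr 1).
by apply: fps_geomP; rewrite coef_fpsD coef_fpsN coef_fpsCM mulVr ?subrr.
Qed.

Lemma fps_unitPl f g : g * f = 1 -> fps_unit f.
Proof.
move=> /(congr1 (@^~ 0%N)); rewrite coef0_fpsM => gf0.
by apply/unitrPr; exists (g 0%N); rewrite mulrC.
Qed.

Lemma fps_inv_out : {in [predC fps_unit], fps_inv =1 id}.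
Proof. by move=> f /negbTE nuf; rewrite /fps_inv [_ \is a _]nuf. Qed.

HB.instance Definition _ :=
  GRing.ComNzRing_hasMulInverse.Build (fps R) fps_mulVf fps_unitPl fps_inv_out.

Lemma fps_unitE f : (f \is a GRing.unit) = (f 0%N \is a GRing.unit).
Proof. by []. Qed.

Lemma unit_1subfpsX n : (1 - fpsX ^+ n.+1 : fps R) \is a GRing.unit.
Proof. by rewrite fps_unitE coef_fpsD coef_fpsN coef_fpsXn subr0 unitr1. Qed.

Lemma solve_fps_recurrence f g d :
  f = g + fpsX ^+ d.+1 * f -> f = g / (1 - fpsX ^+ d.+1).
Proof.
move=> fE; apply/(canRL (mulrK (unit_1subfpsX d))).
by rewrite mulrBr mulr1 {1}fE [f * _]mulrC addrK.
Qed.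

End FormalPowerSeriesUnits.

(** * Combinatorial classes and their generating functions *)

Lemma set_bij_can (T U : Type) (A : set T) (B : set U)
    (f : T -> U) (g : U -> T) :
    (forall x, A x -> B (f x)) -> (forall y, B y -> A (g y)) ->
    (forall x, A x -> g (f x) = x) -> (forall y, B y -> f (g y) = y) ->
  set_bij A B f.
Proof.
move=> fAB gBA fK gK; split=> [//|x y|y By].
  by rewrite !inE => Ax Ay fxy; rewrite -(fK x) // fxy fK.
by exists (g y); [exact: gBA | exact: gK].
Qed.

Section FiniteSupportSums.
Variables (R : Type) (idx : R) (op : Monoid.com_law idx).

Lemma fsbig_fibers (T K : choiceType) (A : set T) (B : set K)
    (g : T -> K) (F : T -> R) :
    finite_set A -> finite_set B -> (forall x, A x -> B (g x)) ->
  \big[op/idx]_(x \in A) F x =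
  \big[op/idx]_(k \in B) \big[op/idx]_(x \in A `&` g @^-1` [set k]) F x.
Proof.
move=> finA finB gAB.
under [RHS]eq_fsbigr do rewrite fsbig_mkcondr.
rewrite exchange_fsbig //; apply: eq_fsbigr => x; rewrite inE => Ax.
rewrite (fsbigD1 (g x)) //; last exact: gAB.
rewrite mem_set // fsbig1 => [|k [_ /= kN]]; first by rewrite /= Monoid.mulm1.
by rewrite ifF //; apply/negbTE/negP; rewrite inE /= => /esym.
Qed.

Lemma exchange_fsbig_seq (I : eqType) (K : choiceType) (r : seq I)
    (F : I -> K -> R) :
    (forall i, finite_set (F i @^-1` [set~ idx])) ->
  \big[op/idx]_(k \in [set: K]) \big[op/idx]_(i <- r) F i k =
  \big[op/idx]_(i <- r) \big[op/idx]_(k \in [set: K]) F i k.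
Proof.
move=> finF; pose B := \bigcup_(i in [set` r]) (F i @^-1` [set~ idx]).
have finB : finite_set B by apply: bigcup_finite => //; exact: finite_seq.
have FB i k : i \in r -> ~ B k -> F i k = idx.
  by move=> ir Bk; apply: contrapT => Fik; apply: Bk; exists i.
rewrite -(fsbig_widen B) // => [|k [_ Bk]]; last first.
  by rewrite /= big_seq big1 // => i ir; exact: FB.
rewrite fsbig_finite // exchange_big big_seq [RHS]big_seq.
apply: eq_bigr => i ir.
by rewrite -(fsbig_widen B) // ?fsbig_finite // => k [_ Bk]; exact: FB.
Qed.

End FiniteSupportSums.

Lemma mulr_fsumr_finite (R : pzRingType) (T : choiceType) (a : R) (A : set T)
    (F : T -> R) : finite_set A ->
  a * \sum_(x \in A) F x = \sum_(x \in A) a * F x.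
Proof. exact: (fsbig_distrr (times := *%R) +%R). Qed.

Record comb_class := CombClass {
  objects :> choiceType;
  members : set objects;
  weight : objects -> nat;
  finite_weight : forall n, finite_set (members `&` weight @^-1` [set n])
}.

Definition with_weight (C : comb_class) n : set C :=
  @members C `&` @weight C @^-1` [set n].

Lemma finite_with_weight (C : comb_class) n : finite_set (@with_weight C n).
Proof. exact: finite_weight. Qed.

Definition class_bij (C D : comb_class) (h : C -> D) :=
  set_bij (@members C) (@members D) h
  /\ forall x, members x -> weight (h x) = weight x.

Lemma finite_prod_weight (C D : comb_class) n :
  finite_set (@members C `*` @members D
    `&` (fun x => weight x.1 + weight x.2)%N @^-1` [set n]).
Proof.
have fin E : finite_set (\bigcup_(i in `I_n.+1) @with_weight E i).
  by apply: bigcup_finite => [|i _]; [exact: finite_II|exact: finite_weight].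
apply: sub_finite_set (finite_setX (fin C) (fin D)) => -[x y] [[/= Cx Dy] wxy].
by split; [exists (weight x) | exists (weight y)] => //=; lia.
Qed.

Definition prod_class (C D : comb_class) : comb_class :=
  CombClass (@finite_prod_weight C D).

Lemma finite_shift_weight (C : comb_class) d n :
  finite_set (@members C `&` (fun x => d + weight x)%N @^-1` [set n]).
Proof.
apply: sub_finite_set (@finite_weight C (n - d)) => x [Cx /= wx].
by split=> //=; lia.
Qed.

Definition shift_class d (C : comb_class) : comb_class :=
  CombClass (@finite_shift_weight C d).

Section GeneratingFunctions.
Variable R : comUnitRingType.
Implicit Types C D : comb_class.

Definition gf C (f : C -> R) : fps R := fun n => \sum_(x \in with_weight n) f x.

Lemma eq_gf C (f g : C -> R) :
  (forall x, members x -> f x = g x) -> gf f = gf g.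
Proof.
by move=> fg; apply/funext => n; apply: eq_fsbigr => x; rewrite inE => -[/fg].
Qed.

Lemma gfD C (f g : C -> R) : gf (fun x => f x + g x) = gf f + gf g.
Proof. by apply/funext => n; apply: fsbig_split; exact: finite_with_weight. Qed.

Lemma gfN C (f : C -> R) : gf (fun x => - f x) = - gf f.
Proof.
apply/funext => n; rewrite coef_fpsN /gf !fsbig_finite ?sumrN //.
all: exact: finite_with_weight.
Qed.

Lemma gf0 C (f : C -> R) : (forall x, members x -> f x = 0) -> gf f = 0.
Proof. by move=> f0; apply/funext => n; apply: fsbig1 => x [/f0]. Qed.

Lemma gf_supp1 C x (f : C -> R) :
    members x -> (forall y, members y -> y != x -> f y = 0) ->
  gf f = fpsC (f x) * fpsX ^+ weight x.
Proof.
move=> Cx f0; apply/funext => n; rewrite coef_fpsCM coef_fpsXn.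
have [->|nwx] := eqVneq n (weight x); last first.
  rewrite mulr0; apply: fsbig1 => y [Cy /= wy]; apply: f0 => //.
  by apply: contra_neq nwx => <-.
rewrite mulr1.
transitivity (\sum_(y \in [set x]) f y); last by rewrite fsbig_set1.
apply/esym/fsbig_widen => [y /= -> //|].
by move=> y [[Cy _] /= /eqP]; exact: f0.
Qed.

Lemma gf_bij C D (h : C -> D) (f : C -> R) (g : D -> R) :
    class_bij h -> (forall x, members x -> g (h x) = f x) ->
  gf g = gf f.
Proof.
move=> [[hCD h_inj h_surj] weight_h] gh; apply/funext => n.
rewrite /gf (reindex_fsbig h (@with_weight C n)).
  by apply: eq_fsbigr => x; rewrite inE => -[/gh].
split.
- by move=> x [Cx /= <-]; split; [exact: hCD | rewrite /= weight_h].
- by move=> x y; rewrite !inE => -[Cx _] [Cy _]; apply: h_inj; rewrite inE.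
- move=> y [Dy /= wy]; have [x Cx hxy] := h_surj _ Dy.
  by exists x => //; split => //=; rewrite -weight_h // hxy.
Qed.

Lemma gf_shift d C (f : C -> R) :
  gf (f : shift_class d C -> R) = fpsX ^+ d * gf f.
Proof.
apply/funext => n; rewrite coef_fpsXnM /gf; case: leqP => dn; last first.
  by apply: fsbig1 => x [_ /= wx]; lia.
by apply: eq_fsbigl; apply/seteqP; split => x [Cx /= wx]; split => //=; lia.
Qed.

Definition tensor C D (f : C -> R) (g : D -> R) (x : prod_class C D) : R :=
  f x.1 * g x.2.

Lemma gfX C D (f : C -> R) (g : D -> R) : gf (tensor f g) = gf f * gf g.
Proof.
apply/funext => n.
rewrite coef_fpsM /gf (@fsbig_fibers _ _ _ _ _ _ `I_n.+1 (fun x => weight x.1)).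
- rewrite -fsbig_ord; apply: eq_bigr => -[i /=]; rewrite ltnS => leqin _.
  have -> : @with_weight (prod_class C D) n `&`
      (fun x => weight x.1) @^-1` [set i]
      = @with_weight C i `*` @with_weight D (n - i).
    apply/seteqP; split => -[x y] /=.
      by move=> [[[/= Cx Dy] /= wxy] wx]; do !split=> //=; lia.
    by move=> [[Cx /= wx] [Dy /= wy]]; do !split=> //=; lia.
  rewrite -(pair_fsbig _ (fun x y => f x * g y)); try exact: finite_with_weight.
  rewrite mulrC mulr_fsumr_finite; last exact: finite_with_weight.
  apply: eq_fsbigr => x _ /=; rewrite mulrC mulr_fsumr_finite //.
  exact: finite_with_weight.
- exact: (@finite_with_weight (prod_class C D)).
- exact: finite_II.
- by move=> x [_ /= wx]; lia.
Qed.

Lemma finite_pushforward_support C (K : choiceType) (f : C -> R) (s : C -> K)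
    (phi : K -> R) n :
  finite_set ((fun m =>
    phi m * \sum_(x \in with_weight n `&` s @^-1` [set m]) f x) @^-1` [set~ 0]).
Proof.
apply: sub_finite_set (finite_image s (@finite_with_weight C n)) => m /= sumN0.
apply: contrapT => m_out; apply: sumN0; rewrite fsbig1 ?mulr0 //.
by move=> x [Cx /= sx]; case: m_out; exists x.
Qed.

Lemma fsum_pushforward C (K : choiceType) (f : C -> R) (s : C -> K)
    (phi : K -> R) n :
  \sum_(m \in [set: K])
    phi m * \sum_(x \in with_weight n `&` s @^-1` [set m]) f x =
  gf (fun x => f x * phi (s x)) n.
Proof.
have finC := @finite_with_weight C n.
rewrite /gf (@fsbig_fibers _ _ _ _ _ _ (s @` with_weight n) s) //; last first.
  exact: finite_image.
rewrite -(fsbig_widen (s @` with_weight n) [set: K]) //; last first.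
  move=> m [_ /= mC]; rewrite fsbig1 ?mulr0 // => x [Cx /= sx].
  by case: mC; exists x.
apply: eq_fsbigr => m _; rewrite mulr_fsumr_finite.
  by apply: eq_fsbigr => x; rewrite inE => -[_ /= ->]; rewrite mulrC.
by apply: sub_finite_set finC => x [].
Qed.

End GeneratingFunctions.

Section FormalMoments.
Variable R : comUnitRingType.
Implicit Types C D : comb_class.

(* As if, at each value of [fpsX], [f] were a measure of total mass [Z] on    *)
(* the objects, for which [s] has mean [M] and variance [V].                  *)
Definition has_moments C (f s : C -> R) (Z M V : fps R) :=
  [/\ gf f = Z, gf (fun x => f x * s x) = Z * M &
      gf (fun x => f x * s x ^+ 2) = Z * (M ^+ 2 + V)].

Lemma has_moments_cst0 C (f : C -> R) : has_moments f (fun=> 0) (gf f) 0 0.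
Proof.
by split; rewrite // ?expr0n ?addr0 mulr0 gf0 // => x _; rewrite ?expr0n mulr0.
Qed.

Lemma has_moments_set1 C (x : C) (f s : C -> R) :
    @members C = [set x] -> weight x = 0%N -> f x = 1 -> s x = 0 ->
  has_moments f s 1 0 0.
Proof.
move=> Cx wx fx sx; have x1 y : members y -> y = x by rewrite Cx.
have mass : gf f = 1.
  by rewrite (@gf_supp1 _ _ x) ?wx ?fx ?fpsC1 ?mulr1 ?Cx // => y -> /eqP.
split; rewrite // ?expr0n ?addr0 mulr0 gf0 // => y /x1 ->.
all: by rewrite sx ?expr0n mulr0.
Qed.

Lemma has_momentsN C (f s : C -> R) Z M V :
  has_moments f s Z M V -> has_moments f (fun x => - s x) Z (- M) V.
Proof.
case=> mass mean square; split=> //.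
  by rewrite mulrN -mean -gfN; apply: eq_gf => x _; rewrite mulrN.
by rewrite sqrrN -square; apply: eq_gf => x _; rewrite sqrrN.
Qed.

Lemma has_momentsX C D (f s : C -> R) (g t : D -> R) Z M V Z' M' V' :
    has_moments f s Z M V -> has_moments g t Z' M' V' ->
  has_moments (tensor f g) (fun x => s x.1 + t x.2) (Z * Z') (M + M') (V + V').
Proof.
move=> [f_mass f_mean f_square] [g_mass g_mean g_square]; split.
- by rewrite gfX f_mass g_mass.
- transitivity (gf (fun x =>
      tensor (fun y => f y * s y) g x + tensor f (fun y => g y * t y) x)).
    by apply: eq_gf => x _; rewrite /tensor; ring.
  by rewrite gfD !gfX f_mass f_mean g_mass g_mean; ring.
- pose cross_term := tensor (fun y => f y * s y) (fun y => g y * t y).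
  transitivity (gf (fun x => tensor (fun y => f y * s y ^+ 2) g x
      + tensor f (fun y => g y * t y ^+ 2) x + (cross_term x + cross_term x))).
    by apply: eq_gf => x _; rewrite /cross_term /tensor; ring.
  rewrite !gfD !gfX f_mass f_mean f_square g_mass g_mean g_square.
  by ring.
Qed.

Lemma has_moments_bij C D (h : C -> D) (f s : C -> R) (g t : D -> R) Z M V :
    class_bij h ->
    (forall x, members x -> g (h x) = f x) ->
    (forall x, members x -> t (h x) = s x) ->
  has_moments f s Z M V -> has_moments g t Z M V.
Proof.
move=> hbij gh th [mass mean square].
split; [rewrite -mass | rewrite -mean | rewrite -square].
all: by apply: (gf_bij hbij) => x Cx; rewrite ?gh ?th.
Qed.

Lemma has_moments_shift d C (f s : C -> R) Z M V :
    has_moments f s Z M V ->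
  @has_moments (shift_class d C) f s (fpsX ^+ d * Z) M V.
Proof.
case=> mass mean square.
split; [rewrite -mass | rewrite -mulrA -mean | rewrite -mulrA -square].
all: exact: gf_shift.
Qed.

End FormalMoments.

Lemma finite_multiples m n :
  finite_set ([set: nat] `&` muln m.+1 @^-1` [set n]).
Proof.
apply: sub_finite_set (finite_II n.+1) => k [_ /= <-].
by rewrite ltnS leq_pmull.
Qed.

(* The number [k] stands for [k] copies of the part [m.+1]. *)
Definition multiples_class m : comb_class := CombClass (@finite_multiples m).

Section Multiples.
Variables (R : comUnitRingType) (m : nat).
Local Notation class := (multiples_class m).

Lemma coef_gf_multiples (f : class -> R) n :
  gf f n = if (m.+1 %| n)%N then f (n %/ m.+1)%N else 0.
Proof.
rewrite /gf; case: ifP => [dvd_mn|ndvd_mn].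
  have -> : @with_weight class n = [set (n %/ m.+1)%N].
    apply/seteqP; split => k /= => [[_ /= <-]|->]; first by rewrite mulKn.
    by split=> //=; rewrite mulnC divnK.
  by rewrite fsbig_set1.
by apply: fsbig1 => k [_ /= wk]; rewrite -wk dvdn_mulr in ndvd_mn.
Qed.

Lemma gf_multiplesE (f : class -> R) :
  gf f = fpsC (f 0%N) + fpsX ^+ m.+1 * gf (fun k : class => f k.+1).
Proof.
apply/funext => n; rewrite coef_fpsD coef_fpsXnM !coef_gf_multiples.
case: ltnP => [ltmn|]; last first.
  case: n => [_|n lenm]; first by rewrite dvdn0 div0n addr0.
  by rewrite gtnNdvd // addr0.
rewrite -{1 2}(subnK ltmn) dvdn_addl // divnDr // divnn /= addn1 /fpsC.
by case: n ltmn => // n _; rewrite add0r.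
Qed.

Lemma gf_multiples1 : gf (fun _ : class => 1 : R) = (1 - fpsX ^+ m.+1)^-1.
Proof.
rewrite -[RHS]mul1r; apply: solve_fps_recurrence.
by rewrite {1}gf_multiplesE fpsC1.
Qed.

Lemma gf_multiples_id : gf (fun k : class => k%:R : R) = lambert fpsX m.+1.
Proof.
rewrite /lambert -exprVn expr2 mulrA; apply: solve_fps_recurrence.
rewrite {1}gf_multiplesE fpsC0 add0r -mulrDr -gf_multiples1 -gfD; congr (_ * _).
by apply: eq_gf => k _; rewrite -natr1 addrC.
Qed.

Lemma has_moments_multiples :
  has_moments (fun=> 1 : R) (fun k : class => k%:R)
    (1 - fpsX ^+ m.+1)^-1 (fpsX ^+ m.+1 / (1 - fpsX ^+ m.+1))
    (lambert fpsX m.+1).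
Proof.
have square : gf (fun k : class => k%:R ^+ 2 : R) =
    fpsX ^+ m.+1 * ((1 - fpsX ^+ m.+1)^-1 + lambert fpsX m.+1 *+ 2)
    / (1 - fpsX ^+ m.+1).
  apply: solve_fps_recurrence.
  rewrite {1}gf_multiplesE expr0n fpsC0 add0r -mulrDr mulr2n.
  rewrite -gf_multiples1 -gf_multiples_id -!gfD; congr (_ * _).
  by apply: eq_gf => k _; rewrite -natr1; ring.
split; first exact: gf_multiples1; under eq_fun do rewrite mul1r.
  by rewrite gf_multiples_id /lambert -exprVn; ring.
rewrite square /lambert -!exprVn.
move: (fpsX ^+ m.+1) (unit_1subfpsX R m) => x unit_1subx.
transitivity ((1 - x)^-1 *
    ((1 - x) / (1 - x) * (x / (1 - x)) + x / (1 - x) * (x / (1 - x)) *+ 2)).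
  by rewrite divrr //; ring.
by ring.
Qed.

End Multiples.

(** * Partitions *)

Lemma sorted_geq_cat s1 s2 :
  sorted geq (s1 ++ s2) = [&& allrel geq s1 s2, sorted geq s1 & sorted geq s2].
Proof. by rewrite !(sorted_pairwise (rev_trans leq_trans)) pairwise_cat. Qed.

Lemma sorted_geq_cons a s : sorted geq (a :: s) = all (geq a) s && sorted geq s.
Proof. exact: (path_sortedE (rev_trans leq_trans)). Qed.

Lemma sorted_geq_rcons s a :
  sorted geq (rcons s a) = all (leq a) s && sorted geq s.
Proof. by rewrite -cats1 sorted_geq_cat allrel1r andbT. Qed.

Lemma sorted_geq_nseq_cat a k s :
  all (geq a) s -> sorted geq s -> sorted geq (nseq k a ++ s).
Proof.
move=> sa ss; elim: k => // k IH.
rewrite /= -/(sorted _ (_ :: _)) sorted_geq_cons IH.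
by rewrite all_cat sa all_nseq /= leqnn orbT.
Qed.

Lemma nseq_count_filterK a s : all (geq a) s -> sorted geq s ->
  nseq (count_mem a s) a ++ [seq b <- s | b != a] = s.
Proof.
move=> sa ss; apply: (sorted_eq (rev_trans leq_trans) _ _ ss).
- by move=> x y; rewrite andbC => /anti_leq.
- apply: sorted_geq_nseq_cat; last exact: (sorted_filter (rev_trans leq_trans)).
  by rewrite all_filter; apply: sub_all sa => b /= ab; apply/implyP.
- have /all_pred1P := filter_all (pred1 a) s.
  by rewrite size_filter => <-; rewrite (perm_filterC (pred1 a) s).
Qed.

Lemma count_mem_nseq_cat (T : eqType) (a : T) k s :
  a \notin s -> count_mem a (nseq k a ++ s) = k.
Proof.
move=> /count_memPn a_notin_s.
by rewrite count_cat count_nseq a_notin_s /= eqxx mul1n addn0.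
Qed.

Lemma filter_nseq_cat (T : eqType) (a : T) k s :
  a \notin s -> [seq b <- nseq k a ++ s | b != a] = s.
Proof.
move=> a_notin_s; rewrite filter_cat filter_nseq eqxx.
by apply/all_filterP/allP => b bs; apply: contraNneq a_notin_s => <-.
Qed.

Lemma map_addn_subnK c s : all (leq c) s -> map (addn c) (map (subn^~ c) s) = s.
Proof.
move=> /allP sc; rewrite -map_comp -[RHS]map_id; apply/eq_in_map => a /sc /=.
exact: subnKC.
Qed.

Lemma map_addnK c : cancel (map (addn c)) (map (subn^~ c)).
Proof. exact: mapK (addKn c). Qed.

Lemma sumn_map_addn c s : sumn (map (addn c) s) = (size s * c + sumn s)%N.
Proof. by elim: s => //= a s ->; rewrite mulSn; lia. Qed.

Lemma sorted_geq_map_addn c s : sorted geq (map (addn c) s) = sorted geq s.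
Proof.
by rewrite sorted_map; apply: eq_sorted => a b /=; exact: leq_add2l.
Qed.

Definition parts_in lo hi : pred (seq nat) := all (fun a => lo < a <= hi)%N.

Lemma parts_inS lo hi s :
  parts_in lo hi s = parts_in lo hi.+1 s && (hi.+1 \notin s).
Proof.
rewrite -[hi.+1 \notin s]/(~~ (hi.+1 \in s)) -has_pred1 -all_predC -all_predI.
by apply: eq_all => a /=; case: eqP => [->|]; lia.
Qed.

Lemma parts_in_nseq_cat lo hi k s : (lo <= hi)%N -> parts_in lo hi.+1 s ->
  parts_in lo hi.+1 (nseq k hi.+1 ++ s).
Proof.
by move=> lohi ps; rewrite /parts_in all_cat all_nseq ltnS lohi leqnn orbT.
Qed.

Lemma parts_in_filter lo hi s :
  parts_in lo hi.+1 s -> parts_in lo hi [seq a <- s | a != hi.+1].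
Proof.
move=> ps; rewrite parts_inS mem_filter eqxx andbT /parts_in all_filter.
by apply: sub_all ps => a pa /=; apply/implyP.
Qed.

Lemma parts_in_geq lo hi s : parts_in lo hi s -> all (geq hi) s.
Proof. by apply: sub_all => a /andP[]. Qed.

Lemma partition_parts_inE lo hi s :
  is_partition s && parts_in lo hi s = sorted geq s && parts_in lo hi s.
Proof.
rewrite /is_partition -andbA; congr (_ && _); apply/andb_idl => ps.
by apply/negP => /(allP ps).
Qed.

Lemma bounded_partitionE N s :
  is_partition s && (largest s <= N)%N = sorted geq s && parts_in 0 N s.
Proof.
rewrite -partition_parts_inE; case: (boolP (is_partition s)) => //=.
move=> /andP[ss s0]; apply/idP/allP => [sN a as_|]; last first.
  by case: s {ss s0} => // a s /(_ a (mem_head a s)) /andP[].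
rewrite lt0n (memPn s0) //=; case: s ss sN as_ {s0} => // b s.
rewrite sorted_geq_cons inE => /andP[/allP sb _] bN.
by case/predU1P => [-> //|/sb ab]; exact: leq_trans bN.
Qed.

Lemma finite_partition_weight (P : pred (seq nat)) n :
  finite_set ([set s | is_partition s && P s] `&` sumn @^-1` [set n]).
Proof.
apply: sub_finite_set (finite_partitions_sumn_le n) => s [/andP[/= -> _] <-].
exact: leqnn.
Qed.

Definition partition_class (P : pred (seq nat)) : comb_class :=
  CombClass (@finite_partition_weight P).

Definition part_class N : comb_class :=
  partition_class (fun s => largest s <= N)%N.

Definition distinct_class lo hi : comb_class :=
  partition_class (fun s => uniq s && parts_in lo hi s).

Definition durfee_class j : comb_class :=
  partition_class (fun s => durfee s == j).

Lemma finite_padded_weight j n :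
  finite_set ([set s | sorted geq s && (size s == j)] `&` sumn @^-1` [set n]).
Proof.
apply: (@sub_finite_set _ _
    (map succn @^-1` [set s | is_partition s && (sumn s <= n + j)%N])).
  move=> s [/andP[ss /eqP sj] /= sn]; rewrite /is_partition.
  rewrite (sorted_geq_map_addn 1) ss (sumn_map_addn 1) sj sn muln1 addnC leqnn.
  by rewrite andbT; apply/negP => /mapP[].
apply: finite_preimage (finite_partitions_sumn_le _).
by move=> s t _ _ /(inj_map succn_inj).
Qed.

(* Partitions into at most [j] parts, padded with zeros. *)
Definition padded_class j : comb_class := CombClass (@finite_padded_weight j).

Lemma finite_optional_weight m n :
  finite_set ([set: bool] `&` (fun b : bool => b * m.+1)%N @^-1` [set n]).
Proof. exact: finite_finset. Qed.

Definition optional_part_class m : comb_class :=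
  CombClass (@finite_optional_weight m).

Lemma part_class0 : @members (part_class 0) = [set [::]].
Proof.
apply/seteqP; split=> [s|s -> //]; rewrite /= bounded_partitionE => /andP[_].
by case: s => //= a s /andP[]; case: a.
Qed.

Lemma distinct_partitionE lo hi s :
  is_partition s && (uniq s && parts_in lo hi s) =
  [&& sorted geq s, uniq s & parts_in lo hi s].
Proof. by rewrite andbCA partition_parts_inE andbCA. Qed.

Definition push_largest N (x : prod_class (multiples_class N) (part_class N)) :
    part_class N.+1 := nseq x.1 N.+1 ++ x.2.

Lemma push_largest_bij N : class_bij (@push_largest N).
Proof.
split=> [|[k s] _]; last by rewrite /push_largest /= sumn_cat sumn_nseq.
pose peel s := (count_mem N.+1 s, [seq a <- s | a != N.+1]).
apply: (@set_bij_can _ _ _ _ _ peel) => /=.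
- move=> [k s] [_ /=]; rewrite !bounded_partitionE => /andP[ss].
  rewrite parts_inS => /andP[ps _].
  by rewrite parts_in_nseq_cat // sorted_geq_nseq_cat // (parts_in_geq ps).
- move=> s; rewrite !bounded_partitionE => /andP[ss ps]; split=> //=.
  by rewrite parts_in_filter // sorted_filter //; exact: rev_trans leq_trans.
- move=> [k s] [_ /=]; rewrite bounded_partitionE parts_inS => /and3P[_ _ Ns].
  by rewrite /peel count_mem_nseq_cat // filter_nseq_cat.
- move=> s; rewrite bounded_partitionE => /andP[ss ps].
  by rewrite /push_largest nseq_count_filterK // (parts_in_geq ps).
Qed.

Definition raise_all j (x : prod_class (multiples_class j) (padded_class j)) :
    padded_class j.+1 := map (addn x.1) (rcons x.2 0%N).

Lemma raise_all_bij j : class_bij (@raise_all j).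
Proof.
split=> [|[k s] [_ /andP[_ /eqP sj]]]; last first.
  by rewrite /raise_all /= sumn_map_addn sumn_rcons size_rcons sj addn0.
pose lower s := (last 0%N s, map (subn^~ (last 0%N s)) (take j s)).
apply: (@set_bij_can _ _ _ _ _ lower) => /=.
- move=> [k s] [_ /= /andP[ss /eqP sj]].
  rewrite sorted_geq_map_addn size_map size_rcons sj eqxx sorted_geq_rcons ss.
  by rewrite !andbT; apply/allP.
- case/lastP=> [/andP[]//|s c]; rewrite size_rcons eqSS sorted_geq_rcons.
  move=> /andP[/andP[sc ss] /eqP sj]; split=> //=.
  rewrite last_rcons -cats1 take_size_cat // size_map sj eqxx andbT.
  by rewrite -(sorted_geq_map_addn c) map_addn_subnK.
- move=> [k s] [_ /= /andP[_ /eqP sj]]; rewrite /raise_all /lower /=.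
  rewrite map_rcons last_rcons addn0 -cats1 take_size_cat ?size_map //.
  by rewrite map_addnK.
- case/lastP=> [/andP[]//|s c]; rewrite size_rcons eqSS sorted_geq_rcons.
  move=> /andP[/andP[sc _] /eqP sj].
  rewrite /raise_all /lower /= last_rcons -[X in take j X]cats1.
  by rewrite take_size_cat // map_rcons addn0 map_addn_subnK.
Qed.

Lemma leq_durfee i s : (i <= durfee s)%N = (i <= count (leq i) s)%N.
Proof.
apply/idP/idP => [i_durfee|i_count].
  have [|k k_count durfee_k] := @eq_bigmax_cond _
    [pred k : 'I_(size s).+1 | (k <= count (leq k) s)%N] (@nat_of_ord _).
    by apply/card_gt0P; exists ord0.
  have {}durfee_k : durfee s = k := durfee_k.
  rewrite durfee_k in i_durfee; apply: leq_trans (leq_trans k_count _) => //.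
  by apply: sub_count => a /=; exact: leq_trans.
have i_size : (i < (size s).+1)%N.
  by rewrite ltnS (leq_trans i_count) ?count_size.
exact: (@leq_bigmax_cond _ _ (@nat_of_ord (size s).+1) (Ordinal i_size)).
Qed.

Lemma durfee_map_addn_cat j s t :
  size s = j -> all (geq j) t -> durfee (map (addn j) s ++ t) = j.
Proof.
move=> sj tj; apply/eqP; rewrite eqn_leq [(j <= _)%N]leq_durfee.
rewrite leqNgt leq_durfee -leqNgt !count_cat; apply/andP; split.
  rewrite (@eq_in_count _ _ pred0 t) ?count_pred0; last first.
    by move=> a /(allP tj) /=; lia.
  by rewrite addn0 (leq_trans (count_size _ _)) // size_map sj.
rewrite count_map (@eq_count _ _ predT) ?count_predT ?sj ?leq_addr // => a /=.
by rewrite leq_addr.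
Qed.

Lemma sorted_geq_count a i s : sorted geq s ->
  (i <= count (leq a) s)%N = (i <= size s)%N && all (leq a) (take i s).
Proof.
elim: s i => [|b s IH] [|i] //; rewrite sorted_geq_cons => /andP[sb ss] /=.
case: (leqP a b) => [_|ba]; first by rewrite /= add1n !ltnS IH.
rewrite andbF add0n (@eq_in_count _ _ pred0) ?count_pred0 //.
by move=> c /(allP sb) /=; lia.
Qed.

Lemma durfee_take_drop j s : sorted geq s -> durfee s = j ->
  [/\ size (take j s) = j, all (leq j) (take j s) & all (geq j) (drop j s)].
Proof.
move=> ss sj; have := leqnn j; rewrite -{2}sj leq_durfee sorted_geq_count //.
move=> /andP[js tj]; split=> //; first by rewrite size_takel.
have := ltnn j; rewrite -{2}sj leq_durfee -{1}(cat_take_drop j s) count_cat.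
apply: contraFT => /allPn[a aj]; rewrite -ltnNge => ja.
have := ss; rewrite -{1}(cat_take_drop j s) sorted_geq_cat.
move=> /andP[/allrelP sa _].
rewrite (@eq_in_count _ _ predT (take j s)) => [|b /sa/(_ aj) /=]; last by lia.
rewrite count_predT size_takel // -[X in (X <= _)%N]addn1 leq_add2l -has_count.
by apply/hasP; exists a.
Qed.

Definition durfee_glue j
    (x : shift_class (j ^ 2) (prod_class (padded_class j) (part_class j))) :
    durfee_class j := map (addn j) x.1 ++ x.2.

Lemma durfee_glue_bij j : class_bij (@durfee_glue j).
Proof.
split=> [|[s t] [/andP[_ /eqP sj] _]]; last first.
  by rewrite /durfee_glue /= sumn_cat sumn_map_addn sj mulnn addnA.
pose split_square s := (map (subn^~ j) (take j s), drop j s).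
apply: (@set_bij_can _ _ _ _ _ split_square) => /=.
- move=> [s t] [/andP[/= ss /eqP sj]]; rewrite bounded_partitionE.
  move=> /andP[st pt]; have tj := parts_in_geq pt.
  rewrite durfee_map_addn_cat // eqxx andbT; apply/andP; split.
    rewrite sorted_geq_cat sorted_geq_map_addn ss st !andbT.
    apply/allrelP => _ b /mapP[a _ ->] /(allP tj) /= bj.
    by rewrite (leq_trans bj) ?leq_addr.
  rewrite mem_cat negb_or; apply/andP; split; last by apply/negP => /(allP pt).
  apply/mapP => -[a as_ /esym/eqP]; rewrite addn_eq0 -sj => /andP[/nilP s0 _].
  by rewrite s0 in as_.
- move=> s /andP[/andP[ss s0] /eqP dj].
  have [sj tj dr] := durfee_take_drop ss dj.
  split; rewrite /= ?size_map ?sj ?eqxx.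
    by rewrite andbT -(sorted_geq_map_addn j) map_addn_subnK ?take_sorted.
  rewrite bounded_partitionE drop_sorted //; apply/allP => a ad.
  apply/andP; split; last exact: (allP dr).
  by rewrite lt0n; apply: contraNneq s0 => <-; exact: mem_drop ad.
- move=> [s t] [/andP[_ /eqP sj] _]; rewrite /split_square /durfee_glue /=.
  by rewrite take_size_cat ?drop_size_cat ?size_map // map_addnK.
- move=> s /andP[/andP[ss _] /eqP dj]; have [_ tj _] := durfee_take_drop ss dj.
  by rewrite /durfee_glue /= map_addn_subnK // cat_take_drop.
Qed.

Definition push_distinct lo hi
    (x : prod_class (optional_part_class hi) (distinct_class lo hi)) :
    distinct_class lo hi.+1 := nseq x.1 hi.+1 ++ x.2.

Lemma push_distinct_bij lo hi :
  (lo <= hi)%N -> class_bij (@push_distinct lo hi).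
Proof.
move=> lohi; split=> [|[b s] _]; last first.
  by rewrite /push_distinct /= sumn_cat sumn_nseq mulnC.
pose peel (s : seq nat) := (hi.+1 \in s, [seq a <- s | a != hi.+1]).
apply: (@set_bij_can _ _ _ _ _ peel) => /=.
- move=> [b s] [_ /=]; rewrite !distinct_partitionE => /and3P[ss us].
  rewrite parts_inS => /andP[ps his].
  rewrite parts_in_nseq_cat // sorted_geq_nseq_cat ?(parts_in_geq ps) //.
  by case: b; rewrite /= ?his us.
- move=> s; rewrite !distinct_partitionE => /and3P[ss us ps]; split=> //=.
  rewrite parts_in_filter // sorted_filter ?filter_uniq //.
  exact: rev_trans leq_trans.
- move=> [b s] [_ /=]; rewrite distinct_partitionE parts_inS.
  move=> /and4P[_ _ _ his]; rewrite /peel filter_nseq_cat // mem_cat.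
  by rewrite (negbTE his) orbF mem_nseq eqxx andbT; case: b.
- move=> s; rewrite distinct_partitionE => /and3P[ss us ps].
  rewrite /push_distinct -count_uniq_mem // nseq_count_filterK //.
  exact: parts_in_geq ps.
Qed.

(** * Generating functions of spt and of the moments *)

Lemma perm_divisors_divn k : (0 < k)%N ->
  perm_eq [seq (k %/ d)%N | d <- divisors k] (divisors k).
Proof.
move=> k0.
have divn_divnK d : d \in divisors k -> (k %/ (k %/ d))%N = d.
  by rewrite -dvdn_divisors // => dk; rewrite divnA // mulKn.
have uniq_quotients : uniq [seq (k %/ d)%N | d <- divisors k].
  by rewrite map_inj_in_uniq ?divisors_uniq //; exact: can_in_inj divn_divnK.
apply: uniq_perm => //; first exact: divisors_uniq.
apply: (uniq_min_size uniq_quotients _ _).2; last by rewrite size_map.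
by move=> _ /mapP[d dk ->]; rewrite -dvdn_divisors // dvdn_div // dvdn_divisors.
Qed.

Lemma sigmaE k N : (0 < k)%N ->
  sigma k N = (\sum_(1 <= i < N.+1 | i %| k) k %/ i)%N.
Proof.
move=> k0; rewrite /sigma -(perm_big _ (perm_divisors_divn k0)) big_map /=.
rewrite -[LHS]big_filter -[RHS]big_filter; apply: perm_big; apply: uniq_perm.
- by rewrite filter_uniq ?divisors_uniq.
- by rewrite filter_uniq ?iota_uniq.
move=> d; rewrite !mem_filter mem_index_iota -dvdn_divisors // ltnS andbC.
case dk: (d %| k)%N => //=; rewrite (dvdn_gt0 k0 dk) /= -{1}(divnK dk).
by rewrite leq_pmul2l // divn_gt0 ?(dvdn_gt0 k0 dk) // dvdn_leq.
Qed.

Definition rank_class N j : comb_class :=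
  prod_class (distinct_class (N - j) N) (durfee_class j).

Definition crank_class N : comb_class :=
  prod_class (prod_class (distinct_class 0 N) (part_class N)) (part_class N).

Lemma partitions_leE n N : partitions_le n N = @with_weight (part_class N) n.
Proof.
apply/seteqP; split=> s; rewrite /partitions_le /=.
  by move=> /and3P[ps /eqP sn sN]; rewrite /with_weight /= ps.
by move=> [/andP[-> ->] /eqP ->].
Qed.

Lemma S1_rank_class N j m n : S1 N j m n =
  @with_weight (rank_class N j) n `&` (fun x => rank x.2) @^-1` [set m].
Proof.
apply/seteqP; split=> -[s t] /=.
  move=> [[ps us sN] [pt dt wE rE]]; do !split=> //=; first exact/and3P.
  by rewrite pt dt eqxx.
by move=> [[[/and3P[ps us sN] /andP[pt /eqP dt]] wE] rE].
Qed.

Lemma S2_crank_class N m n : S2 N m n =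
  @with_weight (crank_class N) n
    `&` (fun x => (size x.1.2)%:Z - (size x.2)%:Z) @^-1` [set m].
Proof.
have parts_in_largest v :
    is_partition v -> parts_in 0 N v = (largest v <= N)%N.
  move=> pv; have := partition_parts_inE 0 N v.
  by rewrite -bounded_partitionE pv.
apply/seteqP; split=> -[[s t] u] /=.
  move=> [[ps us pt pu] [[sN tN uN] [wE mE]]]; do !split=> //=; try exact/andP.
  by apply/and3P; rewrite parts_in_largest.
move=> [[[[/and3P[ps us sN] /andP[pt tN]] /andP[pu uN]] wE] mE].
by rewrite -parts_in_largest.
Qed.

Section PartitionSeries.
Variable R : comUnitRingType.
Local Notation q := (@fpsX R).

Lemma qpoch_fpsX_unit n : qpoch q n \is a GRing.unit.
Proof. exact/qpoch_unit/unit_1subfpsX. Qed.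

Definition mean_parts n : fps R := \sum_(1 <= i < n.+1) q ^+ i / (1 - q ^+ i).

Definition partition_moments (C : comb_class) (s : C -> nat) n :=
  has_moments (fun=> 1 : R) (fun x => (s x)%:R)
    (qpoch q n)^-1 (mean_parts n) (lambert_sum q n).

Lemma partition_moments0 (C : comb_class) (x : C) (s : C -> nat) :
  @members C = [set x] -> weight x = 0%N -> s x = 0%N ->
  partition_moments s 0.
Proof.
move=> Cx wx sx; rewrite /partition_moments /mean_parts big_nil.
rewrite lambert_sum0 qpoch0 invr1.
by apply: has_moments_set1 Cx wx _ _; rewrite ?sx.
Qed.

Lemma partition_momentsS n (C D : comb_class) (s : C -> nat) (t : D -> nat)
    (h : prod_class (multiples_class n) C -> D) :
    class_bij h ->
    (forall k x, members x -> t (h (k, x)) = k + s x)%N ->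
  partition_moments s n -> partition_moments t n.+1.
Proof.
move=> hbij th /(has_momentsX (has_moments_multiples R n)).
rewrite /partition_moments qpochVS; last exact: unit_1subfpsX.
rewrite lambert_sumS [lambert_sum q n + _]addrC.
have -> : mean_parts n.+1 = q ^+ n.+1 / (1 - q ^+ n.+1) + mean_parts n.
  by rewrite /mean_parts big_nat_recr //= addrC.
apply: has_moments_bij hbij _ _ => -[k x] [_ Cx].
  by rewrite /tensor mulr1.
by rewrite th // natrD.
Qed.

Lemma part_class_moments N : @partition_moments (part_class N) size N.
Proof.
elim: N => [|N IH].
  exact: (@partition_moments0 (part_class 0) [::] _ part_class0).
apply: partition_momentsS (push_largest_bij N) _ IH => k s _.
by rewrite /push_largest size_cat size_nseq.
Qed.

Lemma padded_class_moments j : @partition_moments (padded_class j) largest j.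
Proof.
elim: j => [|j IH].
  apply: (@partition_moments0 (padded_class 0) [::]) => //.
  by apply/seteqP; split=> s /=; [case: s => // a s; rewrite andbF | move=> ->].
apply: partition_momentsS (raise_all_bij j) _ IH => k s _.
by rewrite /raise_all /largest; case: s.
Qed.

Lemma durfee_class_moments j : (0 < j)%N ->
  has_moments (fun=> 1 : R) (fun s : durfee_class j => (rank s)%:~R)
    (q ^+ (j ^ 2) / qpoch q j ^+ 2) 0 (lambert_sum q j *+ 2).
Proof.
move=> j0.
have := has_moments_shift (j ^ 2) (has_momentsX (padded_class_moments j)
  (has_momentsN (part_class_moments j))).
rewrite subrr -mulr2n -expr2 exprVn.
apply: has_moments_bij (durfee_glue_bij j) _ _.
  by move=> -[s t] _; rewrite /tensor mulr1.
move=> -[s t] [/andP[_ /eqP sj] _] /=.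
rewrite /rank /durfee_glue size_cat size_map sj /largest.
case: s sj => [j_eq0|a s _ /=]; first by rewrite -j_eq0 in j0.
rewrite PoszD [Posz (j + _)%N]PoszD opprD addrACA subrr add0r.
by rewrite rmorphB !pmulrn.
Qed.

Lemma gf_optional_part m :
  gf (fun b : optional_part_class m => (-1) ^+ b : R) = 1 - q ^+ m.+1.
Proof.
transitivity (gf (fun b : optional_part_class m =>
    (b == false)%:R - (b == true)%:R : R)).
  by apply: eq_gf => -[] _; rewrite ?sub0r ?subr0.
rewrite gfD gfN (@gf_supp1 _ (optional_part_class m) false) => [|//|[]//].
rewrite (@gf_supp1 _ (optional_part_class m) true) => [|//|[]//].
by rewrite /= mul0n mul1n fpsC1 !mul1r.
Qed.

Lemma gf_distinct lo hi : (lo <= hi)%N ->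
  gf (fun s : distinct_class lo hi => (-1) ^+ size s : R) =
  qpoch q hi / qpoch q lo.
Proof.
move=> /subnK <-; elim: (hi - lo)%N => [|d IH].
  rewrite add0n divrr ?qpoch_fpsX_unit //.
  rewrite (@gf_supp1 _ (distinct_class lo lo) [::]) /= ?fpsC1 ?mulr1 //.
  by case=> // a s /and3P[_ _ /= /andP[]]; lia.
rewrite addSn qpochS mulrAC -IH mulrC -gf_optional_part -gfX.
apply: gf_bij (push_distinct_bij (leq_addl d lo)) _ => -[b s] _.
by rewrite /push_distinct /tensor size_cat size_nseq exprD.
Qed.

Definition smallest_mult (s : seq nat) : nat := count_mem (smallest s) s.

Lemma smallest_mult_push N k s : members s ->
  smallest_mult (@push_largest N (k, s)) =
  (smallest_mult s + k * (s == [::]))%N.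
Proof.
rewrite /= bounded_partitionE parts_inS => /and3P[_ _ Ns].
rewrite /push_largest /smallest_mult /smallest /=; case: s Ns => [_|a s Ns].
  rewrite cats0 muln1 add0n -nth_last nth_nseq size_nseq count_nseq.
  by case: k => //= k; rewrite ltnS leqnn eqxx mul1n.
rewrite muln0 addn0 last_cat count_cat count_nseq /=.
by rewrite eq_sym (negbTE (memPn Ns _ (mem_last a s))).
Qed.

Lemma gf_smallest_mult N :
  gf (fun s : part_class N => (smallest_mult s)%:R : R) =
  (\sum_(1 <= i < N.+1) lambert q i * qpoch q i) / qpoch q N.
Proof.
elim: N => [|N IH].
  by rewrite big_nil mul0r; apply: gf0 => s; rewrite part_class0 => ->.
transitivity (gf (fun x : prod_class (multiples_class N) (part_class N) =>
    tensor (fun=> 1) (fun s : part_class N => (smallest_mult s)%:R) x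
    + tensor (fun k : multiples_class N => k%:R)
        (fun s : part_class N => (s == [::])%:R) x : R)).
  apply: gf_bij (push_largest_bij N) _ => -[k s] [_ Cs].
  by rewrite /tensor smallest_mult_push // natrD natrM mul1r.
rewrite gfD !gfX IH gf_multiples1 gf_multiples_id.
rewrite (@gf_supp1 _ (part_class N) [::]) => [|//|s _ /negbTE -> //].
rewrite /= fpsC1 !mulr1 [in RHS]big_nat_recr //= mulrDl.
rewrite mulrK ?qpoch_fpsX_unit //.
by rewrite qpochVS; [rewrite mulrCA mulrA | exact: unit_1subfpsX].
Qed.

Lemma gf_rank_square N j : (0 < j <= N)%N ->
  gf (fun x : rank_class N j => (-1) ^+ size x.1 * (rank x.2)%:~R ^+ 2 : R) =
  (durfee_weight q N j * lambert_sum q j / qpoch q N) *+ 2.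
Proof.
move=> /andP[j0 jN]; have [_ _] := has_momentsX (has_moments_cst0
    (fun s : distinct_class (N - j) N => (-1) ^+ size s : R))
  (durfee_class_moments j0).
rewrite gf_distinct ?leq_subr // addr0 expr0n !add0r mulrnAr => second_moment.
transitivity ((qpoch q N / qpoch q (N - j) * (q ^+ (j ^ 2) / qpoch q j ^+ 2)
    * lambert_sum q j) *+ 2).
  by rewrite -second_moment; apply: eq_gf => x _; rewrite /tensor mulr1 add0r.
congr (_ *+ 2); rewrite /durfee_weight jN expr2.
transitivity (qpoch q N / qpoch q N * (q ^+ (j ^ 2) * qpoch q N
    / qpoch q (N - j) / qpoch q j ^+ 2 * lambert_sum q j)); last by ring.
by rewrite divrr ?qpoch_fpsX_unit // mul1r; ring.
Qed.

Lemma sum_gf_rank_square N :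
  \sum_(1 <= j < N.+1)
    gf (fun x : rank_class N j =>
      (-1) ^+ size x.1 * (rank x.2)%:~R ^+ 2 : R) =
  ((\sum_(1 <= j < N.+1) durfee_weight q N j * lambert_sum q j)
    / qpoch q N) *+ 2.
Proof.
rewrite mulr_suml -sumrMnl big_nat_cond [RHS]big_nat_cond.
by apply: eq_bigr => j /andP[jN _]; exact: gf_rank_square.
Qed.

Lemma gf_crank_square N :
  gf (fun x : crank_class N =>
    (-1) ^+ size x.1.1 * ((size x.1.2)%:R - (size x.2)%:R) ^+ 2 : R) =
  (lambert_sum q N / qpoch q N) *+ 2.
Proof.
have [_ _] := has_momentsX (has_momentsX (has_moments_cst0
    (fun s : distinct_class 0 N => (-1) ^+ size s : R)) (part_class_moments N))
  (has_momentsN (part_class_moments N)).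
rewrite gf_distinct // qpoch0 divr1 divrr ?qpoch_fpsX_unit // mul1r !add0r.
rewrite subrr expr0n add0r -mulr2n mulrnAr mulrC => <-.
by apply: eq_gf => x _; rewrite /tensor !mulr1 add0r.
Qed.

Lemma coef_spt n N : (spt n N)%:R =
  ((\sum_(1 <= i < N.+1) lambert q i * qpoch q i) / qpoch q N) n.
Proof.
rewrite -gf_smallest_mult /spt /gf -partitions_leE.
by rewrite !fsbig_finite ?natr_sum //; exact: finite_partitions_le.
Qed.

Lemma coef_num_part n N : (num_part n N)%:R = (qpoch q N)^-1 n.
Proof.
have [<- _ _] := part_class_moments N.
rewrite /num_part /gf -partitions_leE fsbig_finite; last first.
  exact: finite_partitions_le.
by rewrite big_const_seq count_predT iter_addr_0.
Qed.

Lemma coef_lambert_sum N k : lambert_sum q N k =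
  (\sum_(1 <= i < N.+1 | i %| k) k %/ i)%N%:R.
Proof.
rewrite natr_sum big_mkcond /lambert_sum coef_fps_sum !big_add1 /=.
by apply: eq_bigr => i _; rewrite -gf_multiples_id coef_gf_multiples.
Qed.

Lemma coef0_lambert_sum N : lambert_sum q N 0%N = 0.
Proof. by rewrite coef_lambert_sum big1 // => i _; rewrite div0n. Qed.

End PartitionSeries.

Lemma coef_rank_moment N n : rank_moment 2 N n =
  ((\sum_(1 <= j < N.+1) durfee_weight fpsX N j * lambert_sum fpsX j)
    / qpoch fpsX N : fps int) n *+ 2.
Proof.
rewrite /rank_moment /N_S1; under eq_fsbigr do rewrite mulr_sumr.
under eq_fsbigr do under eq_bigr do rewrite S1_rank_class.
rewrite exchange_fsbig_seq => [|j]; last first.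
  exact: (@finite_pushforward_support int (rank_class N j)).
rewrite -coef_fpsMn -sum_gf_rank_square coef_fps_sum; apply: eq_bigr => j _.
pose class_rank (x : rank_class N j) := rank x.2.
transitivity (gf (fun x : rank_class N j =>
    (-1) ^+ size x.1 * class_rank x ^+ 2) n).
  exact: (fsum_pushforward _ class_rank (fun m => m ^+ 2)).
by apply: (congr1 (@^~ n)); apply: eq_gf => x _; rewrite intz.
Qed.

Lemma coef_crank_moment N n :
  crank_moment 2 N n = (lambert_sum fpsX N / qpoch fpsX N : fps int) n *+ 2.
Proof.
rewrite /crank_moment /M_S2; under eq_fsbigr do rewrite S2_crank_class.
pose class_crank (x : crank_class N) := (size x.1.2)%:Z - (size x.2)%:Z.
transitivity (gf (fun x : crank_class N =>
    (-1) ^+ size x.1.1 * class_crank x ^+ 2) n).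
  exact: (fsum_pushforward _ class_crank (fun m => m ^+ 2)).
rewrite -coef_fpsMn -gf_crank_square.
by apply: (congr1 (@^~ n)); apply: eq_gf => x _; rewrite !natz.
Qed.

Lemma double_spt N n :
  (spt n N)%:R *+ 2 = crank_moment 2 N n - rank_moment 2 N n.
Proof.
rewrite coef_spt coef_crank_moment coef_rank_moment -mulrnBl.
rewrite -coef_fpsN -coef_fpsD -mulrBl sum_lambert_qpoch //.
exact: unit_1subfpsX.
Qed.

Lemma crank_moment_sigma N n : crank_moment 2 N n =
  (\sum_(0 <= j < n) num_part j N * sigma (n - j) N)%N%:R *+ 2.
Proof.
rewrite coef_crank_moment mulrC coef_fpsM; congr (_ *+ 2).
rewrite big_ord_recr /= subnn coef0_lambert_sum mulr0 addr0 natr_sum big_mkord.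
apply: eq_bigr => i _; rewrite natrM coef_num_part coef_lambert_sum.
by rewrite sigmaE ?subn_gt0.
Qed.

Theorem theorem2p4 (N n : nat) (n_gt0 : (0 < n)%N) :
  ((spt n N)%:R = (crank_moment 2 N n - rank_moment 2 N n)%:~R / 2%:R :> rat)
  /\
  ((spt n N)%:R = (\sum_(0 <= j < n) num_part j N * sigma (n - j) N)%N%:R
                  - (rank_moment 2 N n)%:~R / 2%:R :> rat).
Proof.
have half (c : rat) : c *+ 2 / 2%:R = c by rewrite -[c *+ 2]mulr_natr mulfK.
have spt_half : (spt n N)%:R =
    (crank_moment 2 N n - rank_moment 2 N n)%:~R / 2%:R :> rat.
  by rewrite -double_spt rmorphMn rmorph_nat /= half.
split=> //; rewrite spt_half rmorphB mulrBl crank_moment_sigma //.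
by rewrite rmorphMn rmorph_nat /= half.
Qed.
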